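(* Let $Q$ be a $3$-supernilpotent loop. Then: (i) $\mathrm{Nuc}(Q)$ is a normal subloop of $Q$. (ii) $Q/\mathrm{Nuc}(Q)$ is an abelian group and $Q/Z(Q)$ is a $2$-nilpotent group.
   Context: A loop is an algebra $(Q,\cdot,\backslash,/,1)$ in which $1$ is a two-sided identity for $\cdot$, $a\backslash b$ is the unique solution $x$ of $ax=b$, and $b/a$ is the unique solution $x$ of $xa=b$. The nucleus $\mathrm{Nuc}(Q)$ is the subloop of all $a\in Q$ such that $a(uv)=(au)v$, $u(av)=(ua)v$ and $u(va)=(uv)a$ for all $u,v\in Q$. The center $Z(Q)$ is the (always normal) subloop of all $a\in\mathrm{Nuc}(Q)$ with $au=ua$ for all $u\in Q$. A subloop is normal if it is the kernel of a loop homomorphism. A group is $2$-nilpotent if it is nilpotent of class at most $2$. A polynomial on an algebra $A$ is a term in the language of $A$ expanded by all elements of $A$ as constants. An $n$-ary polynomial $p$ on $A$ is absorbing at $(e_1,\dots,e_n)\in A^n$ into $e\in A$ if $p(a_1,\dots,a_n)=e$ whenever $a_1,\dots,a_n\in A$ satisfy $a_i=e_i$ for at least one $i$. The algebra $A$ is $k$-supernilpotent if all polynomials on $A$ in at least $k+1$ variables that are absorbing (at any tuple and into any element) are constant (as functions). *)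

(* Defs.v *)
From HB Require Import structures.
From mathcomp Require Import all_boot.
From mathcomp Require Import boolp classical_sets.

Set Implicit Arguments.
Unset Strict Implicit.
Unset Printing Implicit Defensive.

Local Open Scope classical_set_scope.
Local Open Scope quotient_scope.
Local Open Scope group_scope.

HB.mixin Record UMagma_isLoop Q of UMagma Q := {
  ldiv : Q -> Q -> Q;
  rdiv : Q -> Q -> Q;
  ldivP : forall a b x : Q, a * x = b <-> x = ldiv a b;
  rdivP : forall a b x : Q, x * a = b <-> x = rdiv b a
}.

(* The carrier of a umagmaType is a choiceType, which is no restriction: with
   the axioms of boolp every type carries such a structure. *)
#[short(type="loopType")]
HB.structure Definition Loop := {Q of UMagma_isLoop Q & UMagma Q}.

Bind Scope group_scope with Loop.sort.

Section LoopTheory.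
Variable Q : loopType.
Implicit Types (a b u v x y z w : Q) (N : set Q).

Lemma mulKld a b : a * ldiv a b = b. Proof. exact/ldivP. Qed.
Lemma ldivKl a b : ldiv a (a * b) = b. Proof. by symmetry; apply/ldivP. Qed.
Lemma rdivKr a b : rdiv b a * a = b. Proof. exact/rdivP. Qed.
Lemma mulKrd a b : rdiv (b * a) a = b. Proof. by symmetry; apply/rdivP. Qed.
Lemma loop_mulIl a x y : a * x = a * y -> x = y.
Proof. by move=> e; rewrite -(ldivKl a x) e ldivKl. Qed.
Lemma loop_mulIr a x y : x * a = y * a -> x = y.
Proof. by move=> e; rewrite -(mulKrd a x) e mulKrd. Qed.

Definition nucleus : set Q :=
  [set a | forall u v, [/\ a * (u * v) = (a * u) * v,
                           u * (a * v) = (u * a) * v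
                         & u * (v * a) = (u * v) * a]].

Definition center : set Q :=
  [set a | nucleus a /\ forall u, a * u = u * a].

Definition is_subloop N : Prop :=
  [/\ N 1,
      forall a b, N a -> N b -> N (a * b),
      forall a b, N a -> N b -> N (ldiv a b)
    & forall a b, N a -> N b -> N (rdiv a b)].

Definition is_loop_hom (L : loopType) (f : Q -> L) : Prop :=
  [/\ f 1 = 1,
      forall a b, f (a * b) = f a * f b,
      forall a b, f (ldiv a b) = ldiv (f a) (f b)
    & forall a b, f (rdiv a b) = rdiv (f a) (f b)].

Definition loop_kernel (L : loopType) (f : Q -> L) : set Q :=
  [set x | f x = 1].

Definition is_normal_subloop N : Prop :=
  is_subloop N /\
  exists (L : loopType) (f : Q -> L), is_loop_hom f /\ N = loop_kernel f.

Definition loop_lcoset x N : set Q := [set x * n | n in N].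

Definition coset_rel N : rel Q := [rel x y | `[< loop_lcoset x N = loop_lcoset y N >]].

Lemma coset_rel_refl N : reflexive (coset_rel N).
Proof. by move=> x; apply/asboolP. Qed.
Lemma coset_rel_sym N : symmetric (coset_rel N).
Proof. by move=> x y; apply/asboolP/asboolP. Qed.
Lemma coset_rel_trans N : transitive (coset_rel N).
Proof. by move=> y x z /asboolP xy /asboolP yz; apply/asboolP; rewrite xy. Qed.

Canonical coset_equiv N : equiv_rel Q :=
  EquivRel (coset_rel N) (@coset_rel_refl N) (@coset_rel_sym N)
           (@coset_rel_trans N).

Definition coset_compatible N : Prop :=
  forall x x' y y', loop_lcoset x N = loop_lcoset x' N ->
    loop_lcoset y N = loop_lcoset y' N ->
  [/\ loop_lcoset (x * y) N = loop_lcoset (x' * y') N,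
      loop_lcoset (ldiv x y) N = loop_lcoset (ldiv x' y') N
    & loop_lcoset (rdiv x y) N = loop_lcoset (rdiv x' y') N].

Lemma normal_compatible N : is_normal_subloop N -> coset_compatible N.
Proof.
case=> _ [L [f [[f1 fM fl fr] ->]]].
have key x y : loop_lcoset x (loop_kernel f) = loop_lcoset y (loop_kernel f)
    <-> f x = f y.
  have sub u v : f u = f v ->
      loop_lcoset u (loop_kernel f) `<=` loop_lcoset v (loop_kernel f).
    move=> e _ [n /= fn <-]; exists (ldiv v (u * n)); last exact: mulKld.
    rewrite /loop_kernel/= fl fM fn mulg1 e.
    by symmetry; apply/ldivP; rewrite mulg1.
  split=> [e|e]; last by apply/seteqP; split; apply: sub.
  have : loop_lcoset x (loop_kernel f) x by exists 1 => //; rewrite mulg1.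
  by rewrite e => -[n /= fn <-]; rewrite fM fn mulg1.
by move=> x x' y y' /key ex /key ey; split; apply/key;
  rewrite ?fM ?fl ?fr ex ey.
Qed.

End LoopTheory.

Arguments nucleus : clear implicits.
Arguments center : clear implicits.

Section CosetLoop.
Variables (Q : loopType) (N : set Q) (cN : coset_compatible N).

Definition coset_loop of coset_compatible N : Type := {eq_quot coset_equiv N}.

Local Notation QN := (coset_loop cN).

HB.instance Definition _ := Choice.on QN.
HB.instance Definition _ := EqQuotient.on QN.

Definition coset_mul (x y : QN) : QN := \pi_QN (repr x * repr y).
Definition coset_one : QN := \pi_QN 1.
Definition coset_ldiv (x y : QN) : QN := \pi_QN (ldiv (repr x) (repr y)).
Definition coset_rdiv (x y : QN) : QN := \pi_QN (rdiv (repr x) (repr y)).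

Lemma coset_piP (x y : Q) :
  \pi_QN x = \pi_QN y <-> loop_lcoset x N = loop_lcoset y N.
Proof. by split=> [/eqmodP/asboolP|e]; last exact/eqmodP/asboolP. Qed.

Lemma coset_reprK (x : Q) :
  loop_lcoset (repr (\pi_QN x)) N = loop_lcoset x N.
Proof. by apply/coset_piP; rewrite reprK. Qed.

Lemma coset_piM (x y : Q) :
  coset_mul (\pi_QN x) (\pi_QN y) = \pi_QN (x * y).
Proof. by apply/coset_piP; case: (cN (coset_reprK x) (coset_reprK y)). Qed.
Lemma coset_pil (x y : Q) :
  coset_ldiv (\pi_QN x) (\pi_QN y) = \pi_QN (ldiv x y).
Proof. by apply/coset_piP; case: (cN (coset_reprK x) (coset_reprK y)). Qed.
Lemma coset_pir (x y : Q) :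
  coset_rdiv (\pi_QN x) (\pi_QN y) = \pi_QN (rdiv x y).
Proof. by apply/coset_piP; case: (cN (coset_reprK x) (coset_reprK y)). Qed.

Lemma coset_mul1g : left_id coset_one coset_mul.
Proof. by move=> x; rewrite -(reprK x) coset_piM mul1g. Qed.
Lemma coset_mulg1 : right_id coset_one coset_mul.
Proof. by move=> x; rewrite -(reprK x) coset_piM mulg1. Qed.
Lemma coset_ldivP (a b x : QN) : coset_mul a x = b <-> x = coset_ldiv a b.
Proof.
split=> [<-|->].
- by rewrite -(reprK a) -(reprK x) coset_piM coset_pil ldivKl.
- by rewrite -(reprK a) -(reprK b) coset_pil coset_piM mulKld.
Qed.
Lemma coset_rdivP (a b x : QN) : coset_mul x a = b <-> x = coset_rdiv b a.
Proof.
split=> [<-|->].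
- by rewrite -(reprK a) -(reprK x) coset_piM coset_pir mulKrd.
- by rewrite -(reprK a) -(reprK b) coset_pir coset_piM rdivKr.
Qed.

HB.instance Definition _ := hasMul.Build QN coset_mul.
HB.instance Definition _ := Magma_isUMagma.Build QN coset_mul1g coset_mulg1.
HB.instance Definition _ := UMagma_isLoop.Build QN coset_ldivP coset_rdivP.

Lemma coset_loop_normal : is_subloop N -> is_normal_subloop N.
Proof.
move=> sN; split=> //; exists QN, \pi_QN; split.
  by split=> // x y; rewrite -?coset_piM -?coset_pil -?coset_pir.
case: sN => N1 NM Nl _; apply/seteqP; split=> x /=.
  move=> Nx; apply/coset_piP/seteqP; split=> _ [n Nn <-].
    by exists (x * n); [exact: NM | rewrite mul1g].
  by exists (ldiv x n); [exact: Nl | rewrite mulKld mul1g].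
move=> /coset_piP e.
have : loop_lcoset x N x by exists 1; rewrite ?mulg1.
by rewrite e => -[n Nn <-]; rewrite mul1g.
Qed.

End CosetLoop.

(* Q/N, for N normal: the loop of left cosets xN. *)
Definition loop_quotient (Q : loopType) (N : set Q)
  (nN : is_normal_subloop N) : loopType := coset_loop (normal_compatible nN).

Section Center.
Variable Q : loopType.
Implicit Types a b x y z w : Q.

Lemma nucleusM a b : nucleus Q a -> nucleus Q b -> nucleus Q (a * b).
Proof.
move=> ha hb.
have al x y : a * (x * y) = (a * x) * y by case: (ha x y).
have am x y : x * (a * y) = (x * a) * y by case: (ha x y).
have bl x y : b * (x * y) = (b * x) * y by case: (hb x y).
have bm x y : x * (b * y) = (x * b) * y by case: (hb x y).
have ar x y : x * (y * a) = (x * y) * a by case: (ha x y).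
have br x y : x * (y * b) = (x * y) * b by case: (hb x y).
split=> /=.
- by rewrite -al bl al al.
- by rewrite -al am bm am.
- by rewrite !br ar.
Qed.

Lemma nucleus_ldiv1 a : nucleus Q a ->
  (forall x, ldiv a x = ldiv a 1 * x) /\ nucleus Q (ldiv a 1).
Proof.
move=> ha; set a' := ldiv a 1; have aa' : a * a' = 1 by exact: mulKld.
have l x : a * (a' * x) = x by case: (ha a' x) => -> _ _; rewrite aa' mul1g.
have l' x : a' * (a * x) = x by apply: (@loop_mulIl _ a); rewrite l.
have a'a : a' * a = 1 by rewrite -[a in _ * a]mulg1 l'.
have r x : (x * a') * a = x.
  by case: (ha x a') => _ _ <-; rewrite a'a mulg1.
split=> [x|u v]; first by rewrite -{1}(l x) ldivKl.
split.
- apply: (@loop_mulIl _ a); rewrite l.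
  by case: (ha (a' * u) v) => -> _ _; rewrite l.
- rewrite -(l v) l'; case: (ha (u * a') (a' * v)) => _ -> _.
  by rewrite r.
- apply: (@loop_mulIr _ a); rewrite r.
  by case: (ha u (v * a')) => _ _ <-; rewrite r.
Qed.

Lemma centerM a b : center Q a -> center Q b -> center Q (a * b).
Proof.
move=> [na ca] [nb cb]; split; first exact: nucleusM.
move=> u; case: (na b u) => <- _ _; rewrite cb.
by case: (na u b) => -> _ _; rewrite ca; case: (na u b) => _ <- _.
Qed.

Lemma center_ldiv a b : center Q a -> center Q b -> center Q (ldiv a b).
Proof.
move=> ha hb; have [na ca] := ha.
have [e na'] := nucleus_ldiv1 na; rewrite e; apply: centerM => //.
split=> // u; apply: (@loop_mulIl _ a).
case: (na (ldiv a 1) u) => -> _ _; rewrite mulKld mul1g.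
case: (na u (ldiv a 1)) => -> _ _; rewrite ca.
by case: (na u (ldiv a 1)) => _ <- _; rewrite mulKld mulg1.
Qed.

Lemma center_subloop : is_subloop (center Q).
Proof.
split; [|exact: centerM|exact: center_ldiv|].
- by split=> [u v|u]; rewrite ?mul1g ?mulg1.
- move=> a b ha hb; suff -> : rdiv a b = ldiv b a by exact: center_ldiv.
  by apply/ldivP; case: hb => _ ->; rewrite rdivKr.
Qed.

Lemma center_mulACA x z y w : center Q z -> center Q w ->
  (x * z) * (y * w) = (x * y) * (z * w).
Proof.
move=> hz hw; have [nzw _] := centerM hz hw; case: hz => nz cz.
case: (nz x (y * w)) => _ <- _; case: (nz y w) => -> _ _.
by rewrite cz; case: (nz y w) => _ <- _; case: (nzw x y).
Qed.

Lemma center_compatible : coset_compatible (center Q).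
Proof.
have [Z1 ZM Zl Zr] := center_subloop.
have sub x z : center Q z ->
    loop_lcoset x (center Q) = loop_lcoset (x * z) (center Q).
  move=> hz; have [nz _] := hz; apply/seteqP; split=> _ [n hn <-].
    exists (ldiv z n); first exact: Zl.
    by case: (nz x (ldiv z n)) => _ <- _; rewrite mulKld.
  by exists (z * n); [exact: ZM | case: (nz x n)].
have key x x' : loop_lcoset x (center Q) = loop_lcoset x' (center Q) ->
    exists2 z, center Q z & x' = x * z.
  move=> e; have : loop_lcoset x' (center Q) x' by exists 1; rewrite ?mulg1.
  by rewrite -e => -[z hz <-]; exists z.
move=> x _ y _ /key[z hz ->] /key[w hw ->]; split.
- by rewrite center_mulACA //; apply: sub; exact: ZM.
- suff -> : ldiv (x * z) (y * w) = ldiv x y * ldiv z w by apply/sub/Zl.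
  by symmetry; apply: (ldivP _ _ _).1; rewrite center_mulACA ?mulKld //; exact: Zl.
- suff -> : rdiv (x * z) (y * w) = rdiv x y * rdiv z w by apply/sub/Zr.
  by symmetry; apply: (rdivP _ _ _).1; rewrite center_mulACA ?rdivKr //; exact: Zr.
Qed.

Lemma center_normal : is_normal_subloop (center Q).
Proof. exact: coset_loop_normal center_compatible center_subloop. Qed.

End Center.

Arguments center_normal : clear implicits.

Section Supernilpotent.
Variable Q : loopType.

Inductive loop_polynomial (n : nat) : Type :=
  | PVar of 'I_n
  | PConst of Q
  | POne
  | PMul of loop_polynomial n & loop_polynomial n
  | PLdiv of loop_polynomial n & loop_polynomial n
  | PRdiv of loop_polynomial n & loop_polynomial n.

Fixpoint peval n (p : loop_polynomial n) (a : 'I_n -> Q) : Q :=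
  match p with
  | PVar i => a i
  | PConst c => c
  | POne => 1
  | PMul p1 p2 => peval p1 a * peval p2 a
  | PLdiv p1 p2 => ldiv (peval p1 a) (peval p2 a)
  | PRdiv p1 p2 => rdiv (peval p1 a) (peval p2 a)
  end.

Definition absorbing n (p : loop_polynomial n) (e : 'I_n -> Q) (c : Q) : Prop :=
  forall a : 'I_n -> Q, (exists i, a i = e i) -> peval p a = c.

Definition supernilpotent (k : nat) : Prop :=
  forall (n : nat) (p : loop_polynomial n) (e : 'I_n -> Q) (c : Q),
    (k.+1 <= n)%N -> absorbing p e c ->
    forall a b : 'I_n -> Q, peval p a = peval p b.

End Supernilpotent.

Definition is_subgroup (G : groupType) (H : set G) : Prop :=
  [/\ H 1, forall x y, H x -> H y -> H (x * y) & forall x, H x -> H x^-1].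

(* Indexed from 0: [lower_central G 0] is G and [lower_central G 1] is G'. *)
Fixpoint lower_central (G : groupType) (n : nat) : set G :=
  if n is m.+1 then
    smallest (@is_subgroup G) [set [~ x, y] | x in @lower_central G m & y in setT]
  else setT.

Arguments lower_central : clear implicits.

Definition nilpotent_class_le (c : nat) (G : groupType) : Prop :=
  lower_central G c = [set 1].

Section AssociativeLoop.
Variables (L : loopType) (assocL : associative (@mul L)).

Definition group_of_loop of associative (@mul L) : Type := L.

Local Notation G := (group_of_loop assocL).

Let loop_inv (x : L) : L := ldiv x 1.

Lemma loop_mulgV : right_inverse 1 loop_inv (@mul L).
Proof. by move=> x; exact: mulKld. Qed.
Lemma loop_mulVg : left_inverse 1 loop_inv (@mul L).
Proof.
move=> x; apply: (@loop_mulIl _ x).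
by rewrite assocL loop_mulgV mul1g mulg1.
Qed.

HB.instance Definition _ := Choice.on G.
HB.instance Definition _ :=
  isGroup.Build G assocL (@mul1g L) (@mulg1 L) loop_mulVg loop_mulgV.

End AssociativeLoop.

Definition is_abelian_group (L : loopType) : Prop :=
  associative (@mul L) /\ commutative (@mul L).

Definition is_nilpotent_group (c : nat) (L : loopType) : Prop :=
  exists assocL : associative (@mul L),
    nilpotent_class_le c (group_of_loop assocL).

(* Main.v *)
(* Nesting commutators and associators so that four variables occur gives a
   polynomial absorbing at (1,1,1,1) into 1, hence equal to 1 in a
   3-supernilpotent loop. So associators are central, commutators [x,y] are
   nuclear, and commutators [[x,y],z] are central. The nucleus is normal since
   a nuclear element can be moved past any other at the cost of a nuclear
   commutator. *)
Require Import Defs.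
From mathcomp Require Import all_boot boolp classical_sets.

Set Implicit Arguments.
Unset Strict Implicit.
Unset Printing Implicit Defensive.

Local Open Scope classical_set_scope.
Local Open Scope quotient_scope.
Local Open Scope group_scope.

(** * Commutators, associators and cosets of nuclear subloops in an arbitrary loop *)

Section LoopCommutators.
Variable Q : loopType.
Implicit Types (a b c n u v x y z w : Q) (N : set Q).

(** The correction factor between x y and y x, placed on the right in [lcomm] and on the left in
    [rcomm]. Multiplication and left division of cosets use the first, right division the second. *)
Definition lcomm x y := ldiv (y * x) (x * y).
Definition rcomm x y := rdiv (x * y) (y * x).
Definition lassoc x y z := ldiv (x * (y * z)) ((x * y) * z).

Lemma lcommE x y : x * y = (y * x) * lcomm x y.
Proof. by rewrite mulKld. Qed.

Lemma rcommE x y : x * y = rcomm x y * (y * x).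
Proof. by rewrite rdivKr. Qed.

Lemma lassocE x y z : (x * y) * z = (x * (y * z)) * lassoc x y z.
Proof. by rewrite mulKld. Qed.

Lemma ldivv x : ldiv x x = 1.
Proof. by rewrite -[X in ldiv _ X](mulg1 x) ldivKl. Qed.

Lemma rdivv x : rdiv x x = 1.
Proof. by rewrite -[X in rdiv X _](mul1g x) mulKrd. Qed.

Lemma lcomm1l x : lcomm 1 x = 1.
Proof. by rewrite /lcomm mulg1 mul1g ldivv. Qed.

Lemma lcomm1r x : lcomm x 1 = 1.
Proof. by rewrite /lcomm mulg1 mul1g ldivv. Qed.

Lemma rcomm1l x : rcomm 1 x = 1.
Proof. by rewrite /rcomm mulg1 mul1g rdivv. Qed.

Lemma rcomm1r x : rcomm x 1 = 1.
Proof. by rewrite /rcomm mulg1 mul1g rdivv. Qed.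

Lemma lassoc1l x y : lassoc 1 x y = 1.
Proof. by rewrite /lassoc !mul1g ldivv. Qed.

Lemma lassoc1m x y : lassoc x 1 y = 1.
Proof. by rewrite /lassoc mulg1 mul1g ldivv. Qed.

Lemma lassoc1r x y : lassoc x y 1 = 1.
Proof. by rewrite /lassoc !mulg1 ldivv. Qed.

(** Multirule for the absorption conditions below: nested commutators and associators with an
    argument 1 collapse from the inside out. *)
Definition absorb1 :=
  (lcomm1l, lcomm1r, rcomm1l, rcomm1r, lassoc1l, lassoc1m, lassoc1r).

Lemma lcomm_eq1 x y : lcomm x y = 1 -> x * y = y * x.
Proof. by move=> e; rewrite lcommE e mulg1. Qed.

Lemma lassoc_eq1 x y z : lassoc x y z = 1 -> x * (y * z) = (x * y) * z.
Proof. by move=> e; rewrite lassocE e mulg1. Qed.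

Lemma nucleus_lassoc a :
  (forall u v, [/\ lassoc a u v = 1, lassoc u a v = 1 & lassoc u v a = 1]) ->
  nucleus Q a.
Proof. by move=> h u v; case: (h u v); split; apply: lassoc_eq1. Qed.

Lemma nucleus_subloop : is_subloop (nucleus Q).
Proof.
split; [by move=> u v; rewrite !mul1g !mulg1|exact: nucleusM| |] => a b ha hb.
  by have [e na] := nucleus_ldiv1 ha; rewrite e; exact: nucleusM.
have [_ nb] := nucleus_ldiv1 hb.
suff -> : rdiv a b = a * ldiv b 1 by exact: nucleusM.
apply: (@loop_mulIr _ b); rewrite rdivKr; case: (hb a (ldiv b 1)) => _ _ <-.
suff -> : ldiv b 1 * b = 1 by rewrite mulg1.
by apply: (@loop_mulIl _ b); case: (hb (ldiv b 1) b) => -> _ _;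
  rewrite mulKld mul1g mulg1.
Qed.

Lemma lcosetMr N x n : is_subloop N -> N `<=` nucleus Q -> N n ->
  loop_lcoset (x * n) N = loop_lcoset x N.
Proof.
move=> [_ NM Nl _] sN Nn; have nn := sN _ Nn; apply/seteqP.
split=> _ [m Nm <-].
  by exists (n * m); [exact: NM | case: (nn x m)].
exists (ldiv n m); first exact: Nl.
by case: (nn x (ldiv n m)) => _ <- _; rewrite mulKld.
Qed.

Lemma lcoset_eqP N x y : N 1 -> loop_lcoset x N = loop_lcoset y N ->
  exists2 n, N n & y = x * n.
Proof.
move=> N1 e; have : loop_lcoset y N y by exists 1; rewrite ?mulg1.
by rewrite -e => -[n hn <-]; exists n.
Qed.

(** A nuclear n satisfies n y = y (n [n,y]) with n [n,y] again nuclear, so nuclear factors can be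
    collected on the right of any product. *)
Lemma nucleus_compatible :
  (forall x y, nucleus Q (lcomm x y)) -> (forall x y, nucleus Q (rcomm x y)) ->
  coset_compatible (nucleus Q).
Proof.
move=> nl nr; have sN := nucleus_subloop; have [N1 NM Nl Nr] := sN.
have nucM x n y m : nucleus Q n -> nucleus Q m ->
    (x * n) * (y * m) = (x * y) * (n * lcomm n y * m).
  move=> hn hm; have hc := nl n y.
  have hnc := NM _ _ hn hc; have hncm := NM _ _ hnc hm.
  case: (hncm x y) => _ _ <-; case: (hn x (y * m)) => _ <- _; congr (x * _).
  case: (hm n y) => _ _ ->; rewrite (lcommE n y).
  by case: (hnc y m) => _ -> _; case: (hn y (lcomm n y)) => _ -> _.
have coset x n : nucleus Q n ->
    loop_lcoset x (nucleus Q) = loop_lcoset (x * n) (nucleus Q).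
  by move=> hn; rewrite (lcosetMr _ sN).
move=> x _ y _ /(lcoset_eqP N1)[n hn ->] /(lcoset_eqP N1)[m hm ->].
split.
- by rewrite nucM //; apply: coset; exact: NM (NM _ _ hn (nl _ _)) hm.
(* By [nucM], (x n)(u r) = (x u)(k r) = y (k r) for nuclear r, so r must solve k r = m. *)
- set u := ldiv x y; set k := n * lcomm n u.
  have hk : nucleus Q k by exact/NM/nl.
  suff -> : ldiv (x * n) (y * m) = u * ldiv k m by exact/coset/Nl.
  symmetry; apply: (ldivP _ _ _).1.
  by rewrite nucM ?mulKld //; exact: Nl.
(* Here u y = x and k m = n, so a nuclear r with u (r y) = u (y k) is wanted. Since y k =
   [rcomm y k] (k y), the choice r = [rcomm y k * k] works. *)
- set u := rdiv x y; set k := rdiv n m.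
  have hk : nucleus Q k by exact: Nr.
  have hck : nucleus Q (rcomm y k * k) by exact/NM/hk/nr.
  suff -> : rdiv (x * n) (y * m) = u * (rcomm y k * k) by exact: coset.
  symmetry; apply: (rdivP _ _ _).1.
  case: (hm (u * (rcomm y k * k)) y) => _ _ ->.
  case: (hck u y) => _ <- _; case: (hk (rcomm y k) y) => _ <- _.
  rewrite -rcommE; case: (hk u y) => _ _ ->; rewrite rdivKr.
  by case: (hk x m) => _ <- _; rewrite rdivKr.
Qed.

End LoopCommutators.

Lemma coset_pi_mul (Q : loopType) (N : set Q) (cN : coset_compatible N)
    (x y : Q) :
  (\pi_(coset_loop cN) x : coset_loop cN) * \pi_(coset_loop cN) y =
  \pi_(coset_loop cN) (x * y).
Proof. exact: coset_piM. Qed.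

Lemma coset_pi_mulr (Q : loopType) (N : set Q) (cN : coset_compatible N)
    (x n : Q) : is_subloop N -> N `<=` nucleus Q -> N n ->
  \pi_(coset_loop cN) (x * n) = \pi_(coset_loop cN) x.
Proof. by move=> sN nN Nn; apply/coset_piP; exact: lcosetMr. Qed.

(** * Absorbing polynomials in a 3-supernilpotent loop *)

Section ThreeSupernilpotent.
Variables (Q : loopType) (hQ : supernilpotent Q 3).
Implicit Types x y z w u v : Q.

Let var (i : nat) : loop_polynomial Q 4 := PVar Q (inord i).

(** The conditions on F say that p is absorbing at (1,1,1,1) into 1. Four variables suffice for p to
    be constant, and its value at the all-ones tuple is 1. *)
Lemma absorbing4 (p : loop_polynomial Q 4) (F : Q -> Q -> Q -> Q -> Q) :
    (forall a, peval p a = F (a (inord 0)) (a (inord 1)) (a (inord 2))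
                             (a (inord 3))) ->
    (forall y z w, F 1 y z w = 1) -> (forall x z w, F x 1 z w = 1) ->
    (forall x y w, F x y 1 w = 1) -> (forall x y z, F x y z 1 = 1) ->
  forall x y z w, F x y z w = 1.
Proof.
move=> pF F1 F2 F3 F4 x y z w.
have abs : absorbing p (fun=> 1) 1.
  move=> a [i]; rewrite pF -(inord_val i).
  by case: i => -[|[|[|[|//]]]] _ /= ->.
have := hQ (leqnn 4) abs (fun i => nth 1 [:: x; y; z; w] i) (fun=> 1).
by rewrite !pF /= !inordK //= F1.
Qed.

(** Terms for [lcomm], [rcomm] and [lassoc]. Their [peval] unfolds to these functions, so the first
    condition of [absorbing4] holds by computation. *)
Let Pl p q : loop_polynomial Q 4 := PLdiv (PMul q p) (PMul p q).
Let Pr p q : loop_polynomial Q 4 := PRdiv (PMul p q) (PMul q p).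
Let Pa p q r : loop_polynomial Q 4 :=
  PLdiv (PMul p (PMul q r)) (PMul (PMul p q) r).

(** An associator of [x,y], u and v, in any of the three positions, is absorbing in x, y, u, v. *)
Lemma lcomm_nucleus x y : nucleus Q (lcomm x y).
Proof.
apply: nucleus_lassoc => u v; pose c := Pl (var 0) (var 1); split.
- by apply: (absorbing4 (p := Pa c (var 2) (var 3))
    (F := fun x y u v => lassoc (lcomm x y) u v)) => *; rewrite ?absorb1.
- by apply: (absorbing4 (p := Pa (var 2) c (var 3))
    (F := fun x y u v => lassoc u (lcomm x y) v)) => *; rewrite ?absorb1.
- by apply: (absorbing4 (p := Pa (var 2) (var 3) c)
    (F := fun x y u v => lassoc u v (lcomm x y))) => *; rewrite ?absorb1.
Qed.

Lemma rcomm_nucleus x y : nucleus Q (rcomm x y).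
Proof.
apply: nucleus_lassoc => u v; pose c := Pr (var 0) (var 1); split.
- by apply: (absorbing4 (p := Pa c (var 2) (var 3))
    (F := fun x y u v => lassoc (rcomm x y) u v)) => *; rewrite ?absorb1.
- by apply: (absorbing4 (p := Pa (var 2) c (var 3))
    (F := fun x y u v => lassoc u (rcomm x y) v)) => *; rewrite ?absorb1.
- by apply: (absorbing4 (p := Pa (var 2) (var 3) c)
    (F := fun x y u v => lassoc u v (rcomm x y))) => *; rewrite ?absorb1.
Qed.

(* An absorbing polynomial such as [[x,y,z],u,v] has five variables; fixing
   v gives a four-variable polynomial with a constant, absorbing as well. *)
Lemma lassoc_center x y z : center Q (lassoc x y z).
Proof.
pose t := Pa (var 0) (var 1) (var 2); split.
  apply: nucleus_lassoc => u v; split.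
  - by apply: (absorbing4 (p := Pa t (var 3) (PConst 4 v))
      (F := fun x y z u => lassoc (lassoc x y z) u v)) => *; rewrite ?absorb1.
  - by apply: (absorbing4 (p := Pa (var 3) t (PConst 4 v))
      (F := fun x y z u => lassoc u (lassoc x y z) v)) => *; rewrite ?absorb1.
  - by apply: (absorbing4 (p := Pa (var 3) (PConst 4 v) t)
      (F := fun x y z u => lassoc u v (lassoc x y z))) => *; rewrite ?absorb1.
move=> u; apply: lcomm_eq1.
by apply: (absorbing4 (p := Pl t (var 3))
  (F := fun x y z u => lcomm (lassoc x y z) u)) => *; rewrite ?absorb1.
Qed.

(** Nuclear as a commutator; it commutes with w because [[[x,y],z],w] is absorbing in its four
    variables. *)
Lemma lcomm_lcomm_center x y z : center Q (lcomm (lcomm x y) z).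
Proof.
split=> [|w]; first exact: lcomm_nucleus.
apply: lcomm_eq1.
by apply: (absorbing4 (p := Pl (Pl (Pl (var 0) (var 1)) (var 2)) (var 3))
  (F := fun x y z w => lcomm (lcomm (lcomm x y) z) w)) => *; rewrite ?absorb1.
Qed.

(** * Normality of the nucleus and the quotients by nucleus and center *)

Lemma nucleus_normal : is_normal_subloop (nucleus Q).
Proof.
have cN := nucleus_compatible lcomm_nucleus rcomm_nucleus.
exact: coset_loop_normal cN (nucleus_subloop Q).
Qed.

(** The two bracketings differ by a central right factor, which the quotient by N kills. Any N
    between center and nucleus is allowed, so that both quotients are covered. *)
Lemma coset_mulA (N : set Q) (cN : coset_compatible N) :
    is_subloop N -> N `<=` nucleus Q -> center Q `<=` N ->
  associative (@mul (coset_loop cN)).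
Proof.
move=> sN nN zN; elim/quotW=> x; elim/quotW=> y; elim/quotW=> z.
rewrite (coset_pi_mul cN y z) (coset_pi_mul cN x) (coset_pi_mul cN x y).
rewrite (coset_pi_mul cN _ z) (lassocE x y z); symmetry.
exact: coset_pi_mulr sN nN (zN _ (lassoc_center x y z)).
Qed.

Lemma quotient_nucleus_abelian :
  is_abelian_group (loop_quotient nucleus_normal).
Proof.
split; first by apply: coset_mulA (nucleus_subloop Q) _ _ => // x [].
elim/quotW=> x; elim/quotW=> y; rewrite (coset_pi_mul _ x y) (lcommE x y).
rewrite (coset_pi_mul _ y x).
by apply: coset_pi_mulr (nucleus_subloop Q) _ _ => //; exact: lcomm_nucleus.
Qed.

Lemma quotient_center_nilpotent :
  is_nilpotent_group 2 (loop_quotient (center_normal Q)).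
Proof.
have sZ := center_subloop Q; have nZ : center Q `<=` nucleus Q by move=> x [].
have mA : associative (@mul (loop_quotient (center_normal Q))).
  exact: coset_mulA.
exists mA; pose G : groupType := group_of_loop mA.
pose q (x : Q) : G := \pi_(loop_quotient (center_normal Q)) x.
have qM x y : q x * q y = q (x * y) by exact: coset_pi_mul.
have qr (x : G) : exists x0, x = q x0 by exists (repr x); rewrite /q reprK.
have qZ x n : center Q n -> q (x * n) = q x by exact: coset_pi_mulr.
(* The elements commuting with all of G form a subgroup, so it suffices to show that it contains the
   generating commutators. *)
have derived : lower_central G 1 `<=` [set x : G | forall y : G, commute x y].
  apply: smallest_sub => [|_ [x _ [y _ <-]] z /=].
    split=> /= [y|x y cx cy z|x cx z]; first exact/commute_sym/commute1.
      exact/commute_sym/commuteM/commute_sym/cy/commute_sym/cx.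
    exact/commute_sym/commuteV/commute_sym/cx.
  have [[x0 ->] [y0 ->]] := (qr x, qr y); have [z0 ->] := qr z.
  (* The group commutator satisfies a b = b a [a,b], which is the equation defining [lcomm];
     cancelling b a identifies the two. *)
  have -> : [~ q x0, q y0] = q (lcomm x0 y0).
    apply: (mulgI (q y0 * q x0)).
    by rewrite -commgC !qM -lcommE.
  by rewrite /commute !qM lcommE qZ //; exact: lcomm_lcomm_center.
(* The element 1 lies in every subgroup. Conversely, a generator is [x,y] with x in the derived
   subgroup, hence trivial since x commutes with y. *)
apply/seteqP; split=> [|_ ->]; last by move=> H [[]].
apply: smallest_sub => [|_ [x hx [y _ <-]] /=].
  by split=> //= [x y -> ->|x ->]; rewrite ?mulg1 ?invg1.
by apply: (mulgI (y * x)); rewrite -commgC mulg1; exact: derived.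
Qed.

End ThreeSupernilpotent.

Theorem proposition6p9 (Q : loopType) (hQ : supernilpotent Q 3) :
  exists nN : is_normal_subloop (nucleus Q),
    is_abelian_group (loop_quotient nN) /\
    is_nilpotent_group 2 (loop_quotient (center_normal Q)).
Proof.
exists (nucleus_normal hQ).
by split; [exact: quotient_nucleus_abelian | exact: quotient_center_nilpotent].
Qed.
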